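(* Let $0<\alpha\leq 0.56$ and $0<p<1/(1+\alpha)$. Then there exists a martingale $f\in H_p(G)$ such that $$\sup_{n\in\mathbb{N}}\left\Vert\sigma^{\alpha}_{2^n}f\right\Vert_{weak-L_p}=\infty .$$
   Context: $\mathbb{N}=\{0,1,2,\dots\}$. $G=\prod_{j=0}^{\infty}\mathbb{Z}_2$ is the compact group of sequences $x=(x_0,x_1,\dots)$, $x_j\in\{0,1\}$, with coordinatewise addition mod 2, the product topology, and normalized Haar measure $\mu$ (the product of the measures on $\mathbb{Z}_2$ giving each point mass $1/2$). $I_0(x)=G$ and $I_n(x)=\{y\in G: y_0=x_0,\dots,y_{n-1}=x_{n-1}\}$. For $n=\sum_j n_j2^j$ with $n_j\in\{0,1\}$, the Walsh functions are $w_n(x)=\prod_{k=0}^\infty (-1)^{n_kx_k}$. A martingale $f=(f^{(n)},n\in\mathbb{N})$ is a (real-valued, integrable) martingale with respect to the $\sigma$-algebras $\mathcal{F}_n$ generated by $\{I_n(x):x\in G\}$. For $0<p<\infty$, $f\in H_p(G)$ means $\|f\|_{H_p}:=\|f^*\|_p<\infty$, where $f^*=\sup_n|f^{(n)}|$ and $\|g\|_p=(\int_G|g|^p\,d\mu)^{1/p}$. The Walsh–Fourier coefficients of a martingale are $\widehat f(i)=\lim_{k\to\infty}\int_G f^{(k)}w_i\,d\mu$, and its partial sums are $S_nf=\sum_{k=0}^{n-1}\widehat f(k)w_k$. The weak quasi-norm is $\|g\|_{weak-L_p}=\left(\sup_{\lambda>0}\lambda^p\mu(\{|g|>\lambda\})\right)^{1/p}$.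 The Cesàro $(C,\alpha)$ means are $$\sigma_n^{\alpha}f=\frac1{A_n^{\alpha}}\sum_{k=1}^nA_{n-k}^{\alpha-1}S_kf,$$ where, for real $\gamma\ne-1,-2,\dots$, $A_0^{\gamma}=1$ and $A_n^{\gamma}=\frac{(\gamma+1)(\gamma+2)\cdots(\gamma+n)}{n!}$ for $n\ge1$. *)

(* Defs.v *)
From HB Require Import structures.
From mathcomp Require Import all_boot all_order all_algebra.
From mathcomp Require Import all_classical all_reals all_analysis.

Set Implicit Arguments.
Unset Strict Implicit.
Unset Printing Implicit Defensive.

Import Order.TTheory GRing.Theory Num.Theory.
Import numFieldNormedType.Exports.

Local Open Scope classical_set_scope.
Local Open Scope ring_scope.

(* The Borel space of the product topology on {0,1}^nat; [x k : bool] is the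
   coordinate x_k, addition mod 2 being [addb]. *)
Notation dyadic_group := (g_sigma_algebraType (@open cantor_space)).

Definition dyadic_add (x y : dyadic_group) : dyadic_group :=
  fun k => addb (x k) (y k).

Definition dyadic_interval (n : nat) (x : dyadic_group) : set dyadic_group :=
  [set y | forall k, (k < n)%N -> y k = x k].

(* x + A is written as the preimage of A under translation by x, since
   x + x = 0. *)
Definition is_haar (R : realType) (mu : probability dyadic_group R) : Prop :=
  forall (x : dyadic_group) (A : set dyadic_group), measurable A ->
    mu (dyadic_add x @^-1` A) = mu A.

Section martingales.
Variables (R : realType) (mu : probability dyadic_group R).

Definition dyadic_filtration (n : nat) : set (set dyadic_group) :=
  <<s range (dyadic_interval n) >>.

Definition dyadic_martingale (f : nat -> dyadic_group -> R) : Prop :=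
  [/\ forall n, mu.-integrable setT (EFin \o f n),
      forall n (B : set R), measurable B -> dyadic_filtration n (f n @^-1` B)
    & forall m n (A : set dyadic_group), (m <= n)%N -> dyadic_filtration m A ->
        \int[mu]_(x in A) f n x = \int[mu]_(x in A) f m x].

Definition maximal_fun (f : nat -> dyadic_group -> R) (x : dyadic_group)
  : \bar R := ereal_sup (range (fun n => `|f n x|%:E)).

Definition in_Hp (p : R) (f : nat -> dyadic_group -> R) : Prop :=
  (Lnorm mu p%:E (maximal_fun f) < +oo)%E.

(* [odd (n %/ 2 ^ k)] is the binary digit n_k; it is 0 for k >= n, so the
   infinite product stops there. *)
Definition walsh (n : nat) (x : dyadic_group) : R :=
  \prod_(k < n) (-1) ^+ (odd (n %/ 2 ^ k) * x k)%N.

Definition walsh_coef (f : nat -> dyadic_group -> R) (i : nat) : R :=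
  limn (fun k => \int[mu]_x (f k x * walsh i x)).

Definition walsh_sum (f : nat -> dyadic_group -> R) (n : nat)
    (x : dyadic_group) : R :=
  \sum_(k < n) walsh_coef f k * walsh k x.

Definition cesaro_number (g : R) (n : nat) : R :=
  (\prod_(1 <= i < n.+1) (g + i%:R)) / n`!%:R.

Definition cesaro_mean (alpha : R) (f : nat -> dyadic_group -> R) (n : nat)
    (x : dyadic_group) : R :=
  (cesaro_number alpha n)^-1 *
  \sum_(1 <= k < n.+1) cesaro_number (alpha - 1) (n - k) * walsh_sum f k x.

Definition weak_Lnorm (p : R) (g : dyadic_group -> R) : \bar R :=
  (ereal_sup [set (l `^ p)%:E * mu [set x | (l < `|g x|)%R]
             | l in [set l : R | (0 < l)%R]] `^ p^-1)%E.

End martingales.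

Section haar_measure.
Variable R : realType.
Local Notation G := dyadic_group.

Lemma dyadic_interval_refl n (x : G) : dyadic_interval n x x.
Proof. by []. Qed.

Lemma dyadic_interval_eq n (x y : G) :
  dyadic_interval n x y -> dyadic_interval n x = dyadic_interval n y.
Proof.
move=> xy; apply/seteqP; split=> z zn k kn; first by rewrite (zn k kn) xy.
by rewrite (zn k kn) xy.
Qed.

Lemma dyadic_intervalS n (x : G) : dyadic_interval n.+1 x =
  dyadic_interval n x `&` [set y | y n = x n].
Proof.
apply/seteqP; split=> [y yn|y [yn ynn] k].
  by split=> [k kn|] /=; apply: yn => //; exact: ltnW.
by rewrite ltnS leq_eqVlt => /orP[/eqP->//|]; exact: yn.
Qed.

Lemma dyadic_interval_sub m n (x : G) : (m <= n)%N ->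
  dyadic_interval n x `<=` dyadic_interval m x.
Proof. by move=> mn y yn k km; apply: yn; exact: leq_trans mn. Qed.

Lemma dyadic_interval_open n (x : G) :
  open (dyadic_interval n x : set cantor_space).
Proof.
elim: n => [|n IH].
  rewrite (_ : dyadic_interval 0 x = setT); first exact: openT.
  by apply/seteqP; split.
rewrite dyadic_intervalS; apply: openI => //.
apply: (@open_comp cantor_space bool (fun y => y n) [set x n]).
  by move=> y _; exact: (@proj_continuous nat (fun=> bool) n y).
exact: discrete_open.
Qed.

Lemma dyadic_interval_measurable n (x : G) : measurable (dyadic_interval n x).
Proof. by apply: sub_sigma_algebra; exact: dyadic_interval_open. Qed.

Lemma open_dyadic_interval (U : set cantor_space) (x : G) :
  open U -> U x -> exists n, dyadic_interval n x `<=` U.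
Proof.
move=> oU Ux.
pose F : set_system cantor_space :=
  filter_from setT (fun n => dyadic_interval n x).
have FF : Filter F.
  apply: filter_from_filter; first by exists 0%N.
  move=> i j _ _; exists (maxn i j) => // y yij; split.
    by apply: dyadic_interval_sub yij; rewrite leq_maxl.
  by apply: dyadic_interval_sub yij; rewrite leq_maxr.
suff : F --> (x : cantor_space).
  move=> /(_ U); case; first by apply: open_nbhs_nbhs.
  by move=> n _ nU; exists n.
apply/cvg_sup => i; apply/cvg_image.
  by apply/seteqP; split=> // b _; exists (fun=> b).
move=> A /nbhs_singleton Ax; rewrite nbhs_simpl/=.
exists [set y : cantor_space | A (y i)].
  by exists i.+1 => // y /(_ i (ltnSn _)) yi /=; rewrite yi.
apply/seteqP; split=> [_ [y Ay <-]//|b Ab].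
by exists (fun=> b).
Qed.

Definition dyadic_point (s : seq bool) : G := nth false s.

Lemma open_bigcup_dyadic_interval (U : set cantor_space) : open U ->
  U = \bigcup_(s in [set s | dyadic_interval (size s) (dyadic_point s) `<=` U])
        dyadic_interval (size s) (dyadic_point s).
Proof.
move=> oU; apply/seteqP; split=> [x Ux|x [s sU]]; last exact: sU.
have [n nU] := open_dyadic_interval oU Ux.
have E : dyadic_interval n (dyadic_point (mkseq x n)) x.
  by move=> k kn; rewrite /dyadic_point nth_mkseq.
exists (mkseq x n); rewrite /= size_mkseq//.
by rewrite (dyadic_interval_eq E).
Qed.

Lemma measurable_fun_dyadic d (T : measurableType d) (f : T -> G) :
  (forall n x, measurable (f @^-1` dyadic_interval n x)) ->
  measurable_fun setT f.
Proof.
move=> mf; apply: (@measurability _ _ _ _ setT f (@open cantor_space)) => //.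
move=> _ [U oU <-]; rewrite setTI (open_bigcup_dyadic_interval oU).
rewrite preimage_bigcup bigcup_mkcond.
apply: countable_bigcupT_measurable => // s.
by case: ifP => // _; exact: mf.
Qed.

Lemma dyadic_add_preimage (x y : G) n :
  dyadic_add x @^-1` dyadic_interval n y = dyadic_interval n (dyadic_add x y).
Proof.
apply/seteqP; split=> z /= zn k kn; have := zn k kn; rewrite /dyadic_add.
  by move=> <-; rewrite addbA addbb.
by move=> ->; rewrite addbA addbb.
Qed.

Lemma measurable_dyadic_add (x : G) : measurable_fun setT (dyadic_add x).
Proof.
apply: measurable_fun_dyadic => n y; rewrite dyadic_add_preimage.
exact: dyadic_interval_measurable.
Qed.

(* The normalized Haar measure is the product of the uniform measures. *)
Lemma haar_dyadic_interval (mu : probability G R) n (x : G) :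
  is_haar mu -> mu (dyadic_interval n x) = (2^-1 ^+ n)%:E.
Proof.
move=> hmu; elim: n x => [|n IH] x.
  rewrite (_ : dyadic_interval 0 x = setT) ?probability_setT//.
  by apply/seteqP; split.
pose e : G := fun k => k == n.
have E : dyadic_interval n x =
    dyadic_interval n.+1 x `|` dyadic_interval n.+1 (dyadic_add e x).
  rewrite !dyadic_intervalS; apply/seteqP; split=> [y yn|y [[]//|[yn _]]] /=.
    have [yx|/eqP yx] := eqVneq (y n) (x n); [left|right]; split=> //.
      move=> k kn; rewrite yn// /dyadic_add /e.
      by rewrite (ltn_eqF kn).
    by rewrite /dyadic_add /e eqxx; case: (y n) (x n) yx => -[].
  by move=> k kn; rewrite yn// /dyadic_add /e (ltn_eqF kn).
have D : dyadic_interval n.+1 x `&` dyadic_interval n.+1 (dyadic_add e x) = set0.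
  apply/seteqP; split=> // y [yx ye]; have := ye n (ltnSn n).
  by rewrite (yx n (ltnSn n)) /dyadic_add /e eqxx; case: (x n).
have mI := dyadic_interval_measurable.
have S : mu (dyadic_interval n x) = (mu (dyadic_interval n.+1 x) +
    mu (dyadic_interval n.+1 (dyadic_add e x)))%E.
  by rewrite [in LHS]E; exact: measureU.
have := IH x; rewrite S -dyadic_add_preimage hmu//.
have : mu (dyadic_interval n.+1 x) \is a fin_num.
  exact: fin_num_measure.
case: (mu _) => [r _| |]//; rewrite -EFinD => -[rr]; congr EFin.
by rewrite exprS -rr -mulr2n mulrC -[r *+ 2]mulr_natr mulfK// pnatr_eq0.
Qed.

Lemma haar_of_dyadic_interval (mu : probability G R) :
  (forall n x, mu (dyadic_interval n x) = (2^-1 ^+ n)%:E) -> is_haar mu.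
Proof.
move=> hmu x A mA.
pose H : set (set G) :=
  [set B | B = set0 \/ exists n y, B = dyadic_interval n y].
have HE : measurable = <<s H >> :> set (set G).
  apply/seteqP; split.
    apply: smallest_sub; first exact: smallest_sigma_algebra.
    move=> U oU; rewrite (open_bigcup_dyadic_interval oU) bigcup_mkcond.
    apply: (@countable_bigcupT_measurable _ (g_sigma_algebraType H)) => // s.
    case: ifP => // _; apply: sub_sigma_algebra; right.
    by exists (size s), (dyadic_point s).
  apply: smallest_sub; first exact: sigma_algebra_measurable.
  by move=> B [->//|[n [y ->]]]; exact: dyadic_interval_measurable.
pose tr : {mfun G >-> G} :=
  mfun_Sub (mem_set (measurable_dyadic_add x : [set f | _] _)).
rewrite -[LHS]/(distribution mu tr A).
apply: (@measure_unique _ _ _ H (fun=> setT)) => //.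
- move=> B C [->|[n [y ->]]]; first by rewrite set0I; left.
  move=> [->|[m [z ->]]]; first by rewrite setI0; left.
  have [->|/set0P[w [wy wz]]] :=
    eqVneq (dyadic_interval n y `&` dyadic_interval m z) set0; first by left.
  rewrite (dyadic_interval_eq wy) (dyadic_interval_eq wz); right.
  have [nm|/ltnW mn] := leqP n m.
    by exists m, w; rewrite setIidr//; exact: dyadic_interval_sub.
  by exists n, w; rewrite setIidl//; exact: dyadic_interval_sub.
- move=> _; right; exists 0%N, (fun=> false).
  by apply/seteqP; split.
- by rewrite bigcup_const.
- move=> B [->|[n [y ->]]]; first by rewrite !measure0.
  rewrite -[LHS]/(mu (dyadic_add x @^-1` dyadic_interval n y)).
  by rewrite -[RHS]/(mu (dyadic_interval n y)) dyadic_add_preimage !hmu.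
- by move=> _; rewrite -ge0_fin_numE ?measure_ge0//; exact: fin_num_measure.
Qed.

Let u (k : nat) (t : R) : nat := Num.truncn (t * 2 ^+ k).

Let digits (t : R) : G := fun k => (t \in `[0, 1[) && odd (u k.+1 t).

Let m (x : G) (n : nat) : nat := \sum_(k < n) x k * 2 ^ (n - k.+1).

Let mS x n : m x n.+1 = ((m x n).*2 + x n)%N.
Proof.
rewrite /m big_ord_recr/= subnn muln1 -muln2 big_distrl/=; congr addn.
apply: eq_bigr => k _; rewrite subSS -mulnA -expnSr -subSn//.
Qed.

Let uS k t : 0 <= t -> u k t = (u k.+1 t)./2.
Proof.
move=> t0; have tk : 0 <= t * 2 ^+ k by rewrite mulr_ge0// exprn_ge0.
have tk1 : 0 <= t * 2 ^+ k.+1 by rewrite mulr_ge0// exprn_ge0.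
apply: truncn_def; have /andP[h1 h2] := truncn_itv tk1.
have := odd_double_half (u k.+1 t); rewrite -/(u k.+1 t) in h1 h2.
set v := (u k.+1 t)./2 => vE; rewrite exprSr mulrA in h1 h2.
have le1 : (v.*2 <= u k.+1 t)%N by rewrite -vE leq_addl.
have le2 : ((u k.+1 t).+1 <= v.+1.*2)%N.
  by rewrite -vE doubleS; case: (odd _); rewrite ?add1n ?add0n.
apply/andP; split.
- rewrite -(@ler_pM2r _ 2)// -natrM muln2; apply: le_trans h1.
  by rewrite ler_nat.
- rewrite -(@ltr_pM2r _ 2)// -[X in _ < X]natrM muln2; apply: lt_le_trans h2 _.
  by rewrite ler_nat.
Qed.

Let digitsP n x t : 0 <= t < 1 ->
  dyadic_interval n x (digits t) <-> u n t = m x n.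
Proof.
move=> t01; have /andP[t0 t1] := t01.
have dE k : digits t k = odd (u k.+1 t) by rewrite /digits in_itv/= t01.
elim: n => [|n IH].
  rewrite /m big_ord0 /u expr0 mulr1; split=> // _.
  by apply: truncn_def; rewrite t0.
rewrite dyadic_intervalS mS; split=> [[/IH un]|un].
  rewrite /= dE => <-; rewrite -un (uS n t0) addnC.
  by rewrite odd_double_half.
split; last by rewrite /= dE un oddD odd_double; case: (x n).
by apply/IH; rewrite (uS n t0) un addnC half_bit_double.
Qed.

Let digits_preimage n x : `[0, 1[ `&` digits @^-1` dyadic_interval n x =
  `[((m x n)%:R / 2 ^+ n : R), (m x n).+1%:R / 2 ^+ n[%classic.
Proof.
have p2 : 0 < 2 ^+ n :> R by rewrite exprn_gt0.
have mlt : ((m x n).+1 <= 2 ^ n)%N.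
  elim: (n) => [|k IH]; first by rewrite /m big_ord0.
  rewrite mS expnS mul2n; apply: (@leq_trans (m x k).+1.*2).
    by rewrite doubleS; case: (x k); rewrite ?addn1 ?addn0.
  by rewrite leq_double.
apply/seteqP; split=> t /=; rewrite !in_itv/=.
  move=> [t01]; have /andP[t0 _] := t01.
  move/(digitsP n x t01) => <-; rewrite ler_pdivrMr// ltr_pdivlMr//.
  by apply: truncn_itv; rewrite mulr_ge0// ltW.
move=> /andP[h1 h2].
have t01 : 0 <= t < 1.
  apply/andP; split; first by apply: le_trans h1; rewrite divr_ge0// ltW.
  apply: (lt_le_trans h2); rewrite ler_pdivrMr// mul1r.
  by rewrite -natrX ler_nat.
split=> //; apply/(digitsP n x t01); apply: truncn_def.
by rewrite -ler_pdivrMr// -ltr_pdivlMr// h1.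
Qed.

Let measurable_digits : measurable_fun [set: measurableTypeR R] digits.
Proof.
apply: measurable_fun_dyadic => n x.
have -> : digits @^-1` dyadic_interval n x =
    (`[0, 1[ `&` digits @^-1` dyadic_interval n x) `|`
    (~` `[0, 1[ `&` [set _ | dyadic_interval n x (fun=> false)]).
  have D0 (t : R) : t \notin `[0, 1[ -> digits t = (fun=> false).
    by move=> t01; apply/funext => k; rewrite /digits (negbTE t01).
  apply/seteqP; split=> [t tx|t [[]//|[/negP/D0 t0 tx]]] /=; last by rewrite t0.
  have [t01|t01] := boolP (t \in `[0, 1[); [left|right]; split=> //.
  by rewrite /= -(D0 t).
apply: measurableU; first by rewrite digits_preimage; exact: measurable_itv.
apply: measurableI; first by apply: measurableC; exact: measurable_itv.
have [h|h] := pselect (dyadic_interval n x (fun=> false)).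
  by rewrite (_ : [set _ | _] = setT)//; apply/seteqP; split.
by rewrite (_ : [set _ | _] = set0)//; apply/seteqP; split.
Qed.

Let unif01 : set (measurableTypeR R) -> \bar R :=
  mrestr lebesgue_measure (measurable_itv `[0 : R, 1[).

#[local] HB.instance Definition _ := Measure.on unif01.

Let unif01_setT : unif01 setT = 1%:E.
Proof.
by rewrite /unif01 /mrestr setTI lebesgue_measure_itv/= lte_fin ltr01 oppr0 adde0.
Qed.

#[local] HB.instance Definition _ :=
  Measure_isProbability.Build _ _ _ unif01 unif01_setT.

Lemma haar_exists : exists mu : probability dyadic_group R, is_haar mu.
Proof.
pose D : {mfun measurableTypeR R >-> G} :=
  mfun_Sub (mem_set (measurable_digits : [set f | _] _)).
exists (distribution unif01 D); apply: haar_of_dyadic_interval => n x.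
rewrite -[LHS]/(lebesgue_measure (digits @^-1` dyadic_interval n x `&` `[0, 1[)).
rewrite setIC digits_preimage lebesgue_measure_itv/= lte_fin.
have p2 : 0 < 2 ^+ n :> R by rewrite exprn_gt0.
rewrite ltr_pM2r ?invr_gt0// ltr_nat ltnSn -EFinD -mulrBl -natrB// subSnn.
by rewrite mul1r exprVn.
Qed.

End haar_measure.

(* Main.v *)
(** Take the martingale with Walsh coefficients [2 ^ (s m)] on each dyadic block
    [2 ^ m <= i < 2 ^ (m + 1)], [m >= 2], where [alpha < s < 1 / p - 1]. Its
    maximal function is at most a constant times [2 ^ ((s + 1) k)] on
    [I_k \ I_(k+1)], hence lies in [L_p] because [(s + 1) p < 1]. On the set
    [x_0 = x_1 = 1], of measure 1/4, summation by blocks of four Walsh functions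
    turns the numerator of the Cesaro mean of order [N = 2 ^ n] into
    [sum_i +-b_i (A_(4i+1) - A_(4i+3))], with [A = A^(alpha-1)] decreasing and
    convex and with [b_0] the largest of the [b_i]. Convexity bounds the terms
    [i >= 1] by [b_0 A_3 / 2], so the sum is at least
    [b_0 (A_1 - 3/2 A_3) = b_0 alpha (4 - (alpha + 1) (alpha + 2)) / 4]
    in absolute value; this is where [alpha <= 0.56] is needed. As [b_0] is of
    order [2 ^ (s n)] and [A^alpha_N] at most of order [2 ^ (alpha n)], the
    means blow up on a fixed set of positive measure. *)
Require Import Defs.
From mathcomp Require Import all_boot all_order all_algebra.
From mathcomp Require Import all_classical all_reals all_analysis.
From mathcomp Require Import measurable_realfun ring lra zify.

Set Implicit Arguments.
Unset Strict Implicit.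
Unset Printing Implicit Defensive.

Import Order.TTheory GRing.Theory Num.Theory.
Import numFieldNormedType.Exports.

Local Open Scope classical_set_scope.
Local Open Scope ring_scope.

Local Notation G := dyadic_group.

(** * Growth, monotonicity and convexity of the Cesàro numbers *)

Lemma ltr_powR {R : realType} (a x y : R) : 1 < a -> x < y -> a `^ x < a `^ y.
Proof.
move=> a1 xy; have a0 : 0 < a by apply: lt_trans a1.
by rewrite /powR gt_eqF// ltr_expR ltr_pM2r// ln_gt0.
Qed.

Lemma exprn_powR {R : realType} (x a : R) n :
  0 <= x -> (x ^+ n) `^ a = (x `^ a) ^+ n.
Proof.
by move=> x0; rewrite -!powR_mulrn ?powR_ge0// -!powRrM [in LHS]mulrC.
Qed.

Lemma cesaro_number0 {R : realType} (g : R) : cesaro_number g 0 = 1.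
Proof. by rewrite /cesaro_number big_nil fact0 divr1. Qed.

Lemma cesaro_numberS {R : realType} (g : R) n :
  cesaro_number g n.+1 = cesaro_number g n * ((g + n.+1%:R) / n.+1%:R).
Proof.
rewrite /cesaro_number big_nat_recr//= factS natrM invfM.
by ring.
Qed.

Lemma cesaro_number_gt0 {R : realType} (g : R) n :
  -1 < g -> 0 < cesaro_number g n.
Proof.
move=> g1; elim: n => [|n IH]; first by rewrite cesaro_number0.
rewrite cesaro_numberS mulr_gt0// divr_gt0//.
by rewrite -natr1; have : 0 <= n%:R :> R by []; lra.
Qed.

Lemma cesaro_number_sub {R : realType} (g : R) n :
  cesaro_number g n - cesaro_number g n.+1 =
  cesaro_number g n * (- g / n.+1%:R).
Proof. by rewrite cesaro_numberS mulrDl divff ?pnatr_eq0//; ring. Qed.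

Lemma cesaro_number_nonincreasing {R : realType} (g : R) m n :
  -1 < g <= 0 -> (m <= n)%N -> cesaro_number g n <= cesaro_number g m.
Proof.
move=> /andP[g1 g0]; elim: n => [|n IH]; first by rewrite leqn0 => /eqP->.
rewrite leq_eqVlt => /predU1P[->//|]; rewrite ltnS => /IH; apply: le_trans.
rewrite -subr_ge0 cesaro_number_sub mulr_ge0//.
  exact/ltW/cesaro_number_gt0.
by rewrite divr_ge0// oppr_ge0.
Qed.

(** The difference at n is A_n * (-g / (n + 1)), a product of two nonnegative factors that both
    decrease with n. *)
Lemma cesaro_number_convex {R : realType} (g : R) n : -1 < g <= 0 ->
  cesaro_number g n.+1 - cesaro_number g n.+2 <=
  cesaro_number g n - cesaro_number g n.+1.
Proof.
move=> g01; have /andP[g1 g0] := g01.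
rewrite !cesaro_number_sub ler_pM//.
- exact/ltW/cesaro_number_gt0.
- by rewrite divr_ge0// oppr_ge0.
- exact: cesaro_number_nonincreasing.
- by rewrite ler_wpM2l ?oppr_ge0// lef_pV2 ?posrE// ler_nat.
Qed.

Lemma cesaro_number_tail {R : realType} (g : R) n : -1 < g <= 0 ->
  \sum_(1 <= i < n.+1)
    (cesaro_number g (4 * i + 1) - cesaro_number g (4 * i + 3))
  <= cesaro_number g 3 / 2.
Proof.
move=> g01; have /andP[g1 _] := g01.
(* By convexity A_(k+2) - A_(k+4) is at most half of A_k - A_(k+4); with k = 4n + 3 these larger
   drops telescope from A_3. *)
suff : \sum_(1 <= i < n.+1)
    (cesaro_number g (4 * i + 1) - cesaro_number g (4 * i + 3))
  <= (cesaro_number g 3 - cesaro_number g (4 * n + 3)) / 2.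
  by have := cesaro_number_gt0 (4 * n + 3) g1; lra.
elim: n => [|n IH]; first by rewrite big_geq// muln0 add0n; lra.
rewrite big_nat_recr//=.
have -> : (4 * n.+1 + 1 = (4 * n + 3).+2)%N by lia.
have -> : (4 * n.+1 + 3 = (4 * n + 3).+4)%N by lia.
move: IH; set k := (4 * n + 3)%N.
have := cesaro_number_convex k g01.
have := cesaro_number_convex k.+1 g01.
have := cesaro_number_convex k.+2 g01.
by lra.
Qed.

Lemma cesaro_number_le_powR {R : realType} (g : R) n : 0 < g ->
  cesaro_number g n.+1 <= (1 + g) * n.+1%:R `^ g.
Proof.
move=> g0; elim: n => [|n IH].
  by rewrite cesaro_numberS cesaro_number0 powR1 !mul1r divr1 addrC mulr1.
rewrite cesaro_numberS.
have n1 : 0 < n.+1%:R :> R by [].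
have n2 : 0 < n.+2%:R :> R by [].
(* With m = n + 2: 1 + g/m <= exp(g/m), and 1/m <= -ln(1 - 1/m) = ln(m / (m - 1)). *)
have step : (g + n.+2%:R) / n.+2%:R <= (n.+2%:R / n.+1%:R) `^ g.
  rewrite mulrDl divff ?gt_eqF// addrC.
  apply: le_trans (expR_ge1Dx _) _.
  rewrite /powR gt_eqF ?divr_gt0// ler_expR ler_wpM2l//; first exact: ltW.
  rewrite -[X in ln X]invrK lnV ?posrE ?invr_gt0 ?divr_gt0// lerNr.
  have -> : (n.+2%:R / n.+1%:R)^-1 = 1 + - n.+2%:R^-1 :> R.
    apply: (mulIf (lt0r_neq0 n2)); rewrite /= [RHS]mulrDl mulNr mulVf ?gt_eqF//.
    by rewrite mul1r invf_div divfK ?gt_eqF// -[in RHS]natr1 addrK.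
  apply: le_ln1Dx; rewrite ltrN2 invf_lt1// ltr1n//.
apply: le_trans (ler_pM _ _ IH step) _.
- by apply/ltW/cesaro_number_gt0; lra.
- by rewrite divr_ge0// addr_ge0//; exact: ltW.
- rewrite -mulrA -powRM ?divr_ge0//.
  by rewrite mulrCA divff ?gt_eqF// mulr1.
Qed.

(** * Walsh functions, and Cesàro sums over blocks of four of them *)

Definition dyadic_shift (x : G) : G := fun k => x k.+1.

Lemma walsh_widen (R : realType) n N (x : G) : (n <= N)%N ->
  walsh R n x = \prod_(k < N) (-1) ^+ (odd (n %/ 2 ^ k) * x k)%N.
Proof.
elim: N => [|N IH]; first by rewrite leqn0 => /eqP->.
rewrite leq_eqVlt => /predU1P[->//|]; rewrite ltnS => nN.
rewrite big_ord_recr/= -IH// divn_small ?mulr1//.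
by apply: leq_ltn_trans nN _; rewrite ltn_expl.
Qed.

Lemma walsh_half (R : realType) n (x : G) :
  walsh R n x = (-1) ^+ (odd n * x 0%N)%N * walsh R n./2 (dyadic_shift x).
Proof.
rewrite (@walsh_widen R n n.+1)// (@walsh_widen R n./2 n); last by lia.
rewrite big_ord_recl/= divn1; congr (_ * _); apply: eq_bigr => k _.
by rewrite /bump/= add1n expnS divnMA divn2.
Qed.

Lemma walsh_quarter (R : realType) q r (x : G) : x 0%N -> x 1%N -> (r < 4)%N ->
  walsh R (4 * q + r) x =
  (-1) ^+ (odd r + odd r./2)%N * walsh R q (dyadic_shift (dyadic_shift x)).
Proof.
move=> x0 x1 r4; rewrite walsh_half x0 walsh_half {1}/dyadic_shift x1 !muln1.
have -> : odd (4 * q + r) = odd r by lia.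
have -> : odd (4 * q + r)./2 = odd r./2 by lia.
have -> : (4 * q + r)./2./2 = q by lia.
by rewrite mulrA -exprD.
Qed.

Lemma normr_walsh (R : realType) n (x : G) : `|walsh R n x| = 1.
Proof.
by rewrite /walsh normr_prod big1// => k _; rewrite normrX normrN1 expr1n.
Qed.

Lemma walsh_dyadic0 (R : realType) m i (x : G) :
  (i < 2 ^ m)%N -> dyadic_interval m (fun=> false) x -> walsh R i x = 1.
Proof.
move=> im mx; rewrite /walsh big1// => k _.
have [km|mk] := ltnP k m; first by rewrite mx// muln0.
by rewrite divn_small ?mul0n// (leq_trans im)// leq_exp2l.
Qed.

Definition basis_point (k : nat) : G := fun j => j == k.

Lemma walsh_flip (R : realType) k i (x : G) : odd (i %/ 2 ^ k) ->
  walsh R i (dyadic_add (basis_point k) x) = - walsh R i x.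
Proof.
move=> ik; have ki : (k < i)%N.
  rewrite ltnNge; apply/negP => le_ik; move: ik.
  by rewrite divn_small// (leq_ltn_trans le_ik)// ltn_expl.
rewrite /walsh (bigD1 (Ordinal ki))//= [in RHS](bigD1 (Ordinal ki))//=.
rewrite -mulNr; congr (_ * _).
  rewrite ik !mul1n /dyadic_add /basis_point eqxx.
  by case: (x k); rewrite ?expr0 ?expr1 ?opprK.
apply: eq_bigr => j /eqP jk; rewrite /dyadic_add /basis_point.
by case: eqP => // E; case: jk; exact: val_inj.
Qed.

Lemma walsh_local (R : realType) i (x y : G) :
  dyadic_interval i x y -> walsh R i x = walsh R i y.
Proof. by move=> xy; apply: eq_bigr => k _; rewrite xy. Qed.

(* On [x_0 = x_1 = 1] the signs within a block of four consecutive Walsh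
   functions are [1, -1, -1, 1], so only the first and third partial sums in
   each block survive. *)
Lemma cesaro_sum_quarter (R : realType) (a c : nat -> R) M (x : G) :
  x 0%N -> x 1%N ->
  (forall q r, (r < 4)%N -> c (4 * q + r)%N = c (4 * q)%N) ->
  \sum_(1 <= k < (4 * M).+1) a (4 * M - k)%N * \sum_(i < k) c i * walsh R i x =
  \sum_(0 <= i < M) (a (4 * i + 3)%N - a (4 * i + 1)%N) *
     (c (4 * (M - i.+1))%N *
      walsh R (M - i.+1) (dyadic_shift (dyadic_shift x))).
Proof.
move=> x0 x1 cE.
pose S k : R := \sum_(i < k) c i * walsh R i x.
pose W q : R := c (4 * q)%N * walsh R q (dyadic_shift (dyadic_shift x)).
have step q r : (r < 4)%N ->
    S (4 * q + r).+1 = S (4 * q + r)%N + (-1) ^+ (odd r + odd r./2)%N * W q.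
  move=> r4; rewrite /S big_ord_recr/= cE// walsh_quarter//.
  by congr (_ + _); rewrite /W mulrCA.
have S0 q : S (4 * q)%N = 0.
  elim: q => [|q IH]; first by rewrite /S big_ord0.
  have -> : (4 * q.+1 = (4 * q + 3).+1)%N by lia.
  rewrite step// addnS step// addnS step// addnS step// addn0 IH/=.
  by rewrite add0n addn0 !expr0 expr1 -signr_odd/= expr0; ring.
(* The induction adds blocks from the left while [M] stays fixed inside the weights; reversing the
   order of the blocks at [m = M] gives the stated sum. *)
suff gen m : (m <= M)%N ->
    \sum_(1 <= k < (4 * m).+1) a (4 * M - k)%N * S k =
    \sum_(0 <= q < m)
      (a (4 * (M - q.+1) + 3)%N - a (4 * (M - q.+1) + 1)%N) * W q.
  rewrite gen// [RHS]big_nat_rev/= !big_nat; apply: eq_bigr => q /andP[_ qM].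
  by congr ((a (4 * _ + 3)%N - a (4 * _ + 1)%N) * W _); lia.
elim: m => [_|m IH mM]; first by rewrite muln0 !big_geq.
have -> : ((4 * m.+1).+1 = (4 * m + 3).+2)%N by lia.
rewrite big_nat_recr/=; last by lia.
rewrite addn3 big_nat_recr/=; last by lia.
rewrite big_nat_recr/=; last by lia.
rewrite big_nat_recr/=; last by lia.
rewrite IH ?(ltnW mM)// [in RHS]big_nat_recr//=.
have -> : S (4 * m).+4 = 0 by rewrite -(S0 m.+1); congr S; lia.
have E1 : S (4 * m).+1 = W m.
  by have := @step m 0 isT; rewrite !addn0 S0 expr0 mul1r add0r.
have E2 : S (4 * m).+2 = 0.
  by have := @step m 1 isT; rewrite addn1 E1/= addn0 expr1 => ->; ring.
have E3 : S (4 * m).+3 = - W m.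
  by have := @step m 2 isT; rewrite addn2 E2/= add0n expr1 => ->; ring.
rewrite E1 E2 E3.
have -> : (4 * M - (4 * m).+1 = 4 * (M - m.+1) + 3)%N by lia.
have -> : (4 * M - (4 * m).+3 = 4 * (M - m.+1) + 1)%N by lia.
by ring.
Qed.

(** * Functions of the first n coordinates *)

(** Pointwise form of measurability for the n-th dyadic sigma-algebra. The free codomain also covers
    sets, as maps into [Prop]. *)
Definition cylindrical {T : Type} (n : nat) (h : G -> T) :=
  forall x y, dyadic_interval n x y -> h x = h y.

Lemma cylindricalW {T : Type} m n (h : G -> T) :
  (m <= n)%N -> cylindrical m h -> cylindrical n h.
Proof. by move=> mn hm x y /(dyadic_interval_sub mn)/hm. Qed.

Lemma dyadic_interval_mkseq n (x : G) :
  dyadic_interval n (dyadic_point (mkseq x n)) x.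
Proof. by move=> k kn; rewrite /dyadic_point nth_mkseq. Qed.

Lemma cylindrical_preimage {T : Type} n (h : G -> T) (B : set T) :
  cylindrical n h -> dyadic_filtration n (h @^-1` B).
Proof.
move=> hn; have -> : h @^-1` B =
    \bigcup_(s in [set s | B (h (dyadic_point s))] `&` [set s | size s = n])
      dyadic_interval n (dyadic_point s).
  apply/seteqP; split=> [x Bx|x [s [/= Bs _] sx]].
    2: by rewrite /= -(hn _ _ sx).
  exists (mkseq x n); last exact: dyadic_interval_mkseq.
  by split=> /=; rewrite ?size_mkseq// (hn _ _ (@dyadic_interval_mkseq n x)).
rewrite bigcup_mkcond.
apply: (@countable_bigcupT_measurable _
  (g_sigma_algebraType (range (dyadic_interval n)))) => // s.
case: ifP => // _; apply: sub_sigma_algebra.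
by exists (dyadic_point s).
Qed.

(** The sets with this property form a sigma-algebra containing the generating intervals. *)
Lemma dyadic_filtration_cylindrical n (A : set G) :
  dyadic_filtration n A -> cylindrical n A.
Proof.
apply: smallest_sub => [|_ [x _ <-] y z yz]; last first.
  apply/propext; split=> xy k kn; first by rewrite (yz k kn) xy.
  by rewrite -(yz k kn) xy.
split=> //.
- by move=> B Bn x y xy; rewrite setTD /setC/= (Bn _ _ xy).
- move=> F Fn x y xy; rewrite /bigcup/=; congr (exists2 _, _ & _).
  by apply/funext => i; rewrite (Fn i _ _ xy).
Qed.

Lemma dyadic_filtration_measurable n (A : set G) :
  dyadic_filtration n A -> measurable A.
Proof.
apply: smallest_sub; first exact: sigma_algebra_measurable.
by move=> _ [x _ <-]; exact: dyadic_interval_measurable.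
Qed.

Lemma cylindrical_measurable d (T : measurableType d) n (h : G -> T) :
  cylindrical n h -> measurable_fun setT h.
Proof.
move=> hn _ Y _; rewrite setTI.
exact: dyadic_filtration_measurable (cylindrical_preimage Y hn).
Qed.

(** * Integration against Haar measure and the dyadic Dirichlet kernels *)

Section haar_integral.
Variables (R : realType) (mu : probability G R) (hmu : is_haar mu).

Lemma cylindrical_integrable n (h : G -> R) :
  cylindrical n h -> mu.-integrable setT (EFin \o h).
Proof.
move=> hn; apply: measurable_bounded_integrable => //.
- exact: fin_num_fun_lty.
- exact: cylindrical_measurable hn.
(* [h] takes only the values at the points coded by the words of length n, so the sum of their
   moduli bounds it. *)
exists (\sum_(t : n.-tuple bool) `|h (dyadic_point t)|); split.
  exact: num_real.
move=> M ltM x _; apply/ltW/(le_lt_trans _ ltM).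
rewrite -(hn _ _ (@dyadic_interval_mkseq n x)).
rewrite (bigD1 (Tuple (introT eqP (size_mkseq x n))))//= lerDl.
exact: sumr_ge0.
Qed.

Lemma Rintegral_translate n (h : G -> R) (e : G) : cylindrical n h ->
  \int[mu]_x h (dyadic_add e x) = \int[mu]_x h x.
Proof.
move=> hn; rewrite /Rintegral; congr fine.
have inth := cylindrical_integrable hn.
pose tr : {mfun G >-> G} :=
  mfun_Sub (mem_set (measurable_dyadic_add e : [set f | _] _)).
have he : cylindrical n (h \o dyadic_add e).
  by move=> x y xy; apply: hn => k kn; rewrite /dyadic_add xy.
(* Invariance says that [mu] is its own image under translation; the rest is a change of
   variables. *)
have -> : (\int[mu]_x (h x)%:E = \int[distribution mu tr]_x (h x)%:E)%E.
  apply: eq_measure_integral => A mA _.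
  by rewrite -[RHS]/(mu (dyadic_add e @^-1` A)) hmu.
rewrite integral_distribution//.
  by apply/measurable_EFinP; exact: cylindrical_measurable hn.
exact: cylindrical_integrable he.
Qed.

Definition dyadic_zero : G := fun=> false.

(* The Dirichlet kernel [D_(2 ^ m)]. *)
Definition dyadic_kernel (m : nat) (x : G) : R :=
  2 ^+ m * \1_(dyadic_interval m dyadic_zero) x.

Lemma cylindrical_kernel m : cylindrical m (dyadic_kernel m).
Proof.
move=> x y xy; rewrite /dyadic_kernel !indicE; congr (_ * _%:R).
congr (_ : bool); apply/idP/idP => /set_mem h; apply/mem_set => k kn.
  by rewrite xy// h.
by rewrite -xy// h.
Qed.

Lemma dyadic_kernel_ge0 m x : 0 <= dyadic_kernel m x.
Proof. by rewrite mulr_ge0// exprn_ge0. Qed.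

Lemma integral_dyadic_kernel m : (\int[mu]_x (dyadic_kernel m x)%:E = 1)%E.
Proof.
rewrite /dyadic_kernel; under eq_integral do rewrite EFinM.
rewrite ge0_integralZl//=; last first.
  apply/measurable_EFinP; apply: measurable_indic.
  exact: dyadic_interval_measurable.
rewrite integral_indic ?setIT//; last exact: dyadic_interval_measurable.
transitivity ((2 ^+ m)%:E * (2^-1 ^+ m)%:E : \bar R)%E.
  by congr (_ * _)%E; exact: haar_dyadic_interval.
by rewrite -EFinM exprVn divff.
Qed.

(** The kernel has integral 1 and lives on the interval around zero where [h] is constant. *)
Lemma Rintegral_kernel m (h : G -> R) : cylindrical m h ->
  \int[mu]_x (dyadic_kernel m x * h x) = h dyadic_zero.
Proof.
move=> hm.
have -> : (fun x => dyadic_kernel m x * h x) =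
    (fun x => h dyadic_zero * dyadic_kernel m x).
  apply/funext => x; rewrite mulrC /dyadic_kernel indicE.
  by case: (boolP (x \in _)) => [/set_mem/hm->//|_]; rewrite !mulr0.
have intK := cylindrical_integrable (@cylindrical_kernel m).
by rewrite RintegralZl// /Rintegral integral_dyadic_kernel mulr1.
Qed.

Lemma cylindrical_walsh m i : (i < 2 ^ m)%N -> cylindrical m (walsh R i).
Proof.
move=> im x y xy; apply: eq_bigr => k _.
have [km|mk] := ltnP k m; first by rewrite xy.
by rewrite divn_small// (leq_trans im)// leq_exp2l.
Qed.

(** If i >= 2^m, flipping the coordinate at the leading binary digit k >= m of i negates the Walsh
    function and preserves the kernel, so the integral equals its own opposite. *)
Lemma Rintegral_kernel_walsh m i :
  \int[mu]_x (dyadic_kernel m x * walsh R i x) = (i < 2 ^ m)%:R.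
Proof.
have [im|mi] := ltnP i (2 ^ m).
  rewrite Rintegral_kernel; first by rewrite (@walsh_dyadic0 _ m).
  exact: cylindrical_walsh.
pose k := trunc_log 2 i.
have i0 : (0 < i)%N by apply: leq_trans mi; rewrite expn_gt0.
have mk : (m <= k)%N by rewrite /k trunc_log_max.
have ik : odd (i %/ 2 ^ k).
  have /andP[h1 h2] := trunc_log_bounds (isT : (1 < 2)%N) i0.
  suff -> : (i %/ 2 ^ k = 1)%N by [].
  apply/eqP; rewrite eqn_leq -ltnS ltn_divLR ?expn_gt0// -expnS h2/=.
  by rewrite leq_divRL ?expn_gt0// mul1n.
pose F x := dyadic_kernel m x * walsh R i x.
have Fcyl : cylindrical (maxn m i) F.
  move=> x y xy; rewrite /F.
  rewrite (cylindricalW (leq_maxl m i) (@cylindrical_kernel m) xy).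
  congr (_ * _); apply: (cylindricalW (leq_maxr m i) _ xy).
  by apply: cylindrical_walsh; rewrite ltn_expl.
have FN x : F (dyadic_add (basis_point k) x) = - F x.
  rewrite /F walsh_flip// mulrN; congr (- (_ * _)).
  apply: cylindrical_kernel => j jm.
  by rewrite /dyadic_add /basis_point ltn_eqF// (leq_trans jm).
have := Rintegral_translate (basis_point k) Fcyl.
under eq_Rintegral do rewrite FN -mulN1r.
rewrite RintegralZl//; last exact: cylindrical_integrable Fcyl.
rewrite -/F => h; suff : \int[mu]_x F x = 0 by [].
by lra.
Qed.

End haar_integral.

(** * The martingale with Walsh coefficients constant on dyadic blocks *)

(** The difference of consecutive kernels is the sum of the Walsh functions of index in [2^m,
    2^(m+1)), so [c m] is their common coefficient. *)
Definition walsh_martingale {R : realType} (c : nat -> R) (n : nat) (x : G) :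
    R :=
  \sum_(m < n) c m * (dyadic_kernel R m.+1 x - dyadic_kernel R m x).

Lemma walsh_martingaleS {R : realType} (c : nat -> R) n x :
  walsh_martingale c n.+1 x = walsh_martingale c n x +
    c n * (dyadic_kernel R n.+1 x - dyadic_kernel R n x).
Proof. by rewrite /walsh_martingale big_ord_recr. Qed.

Lemma cylindrical_walsh_martingale {R : realType} (c : nat -> R) n :
  cylindrical n (walsh_martingale c n).
Proof.
move=> x y xy; apply: eq_bigr => m _; congr (_ * (_ - _)).
  by apply: cylindrical_kernel; apply: dyadic_interval_sub xy.
by apply: cylindrical_kernel; apply: dyadic_interval_sub xy; apply: ltnW.
Qed.

Section martingale.
Variables (R : realType) (mu : probability G R) (hmu : is_haar mu).
Variable c : nat -> R.
Let f := walsh_martingale c.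

(** Used twice: an indicator as [h] gives the martingale property, a Walsh function gives the
    coefficients. *)
Lemma Rintegral_walsh_martingaleS N n (h : G -> R) : cylindrical N h ->
  \int[mu]_x (f n.+1 x * h x) = \int[mu]_x (f n x * h x) +
    c n * (\int[mu]_x (dyadic_kernel R n.+1 x * h x) -
           \int[mu]_x (dyadic_kernel R n x * h x)).
Proof.
move=> hN.
have int k (F : G -> R) : cylindrical k F ->
    mu.-integrable setT (EFin \o (fun x => F x * h x)).
  move=> Fk; apply: (@cylindrical_integrable _ _ (maxn k N)) => x y xy.
  rewrite (cylindricalW (leq_maxl k N) Fk xy).
  by rewrite (cylindricalW (leq_maxr k N) hN xy).
have i1 := int _ _ (@cylindrical_kernel R n.+1).
have i0 := int _ _ (@cylindrical_kernel R n).
have iD : mu.-integrable setT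
    (EFin \o
      (fun x => dyadic_kernel R n.+1 x * h x - dyadic_kernel R n x * h x)).
  exact: (integrableB measurableT i1 i0).
rewrite -RintegralB// -RintegralZl// -RintegralD//; last 2 first.
- exact: int (@cylindrical_walsh_martingale R c n).
- exact: (integrableZl measurableT (c n) iD).
apply: eq_Rintegral => x _; rewrite /f walsh_martingaleS; ring.
Qed.

Lemma walsh_martingaleP : dyadic_martingale mu f.
Proof.
split.
- move=> n.
  exact: cylindrical_integrable (@cylindrical_walsh_martingale R c n).
- move=> n B _.
  exact: cylindrical_preimage (@cylindrical_walsh_martingale R c n).
move=> m n A mn Am.
have hA : cylindrical m (\1_A : G -> R).
  move=> x y xy; rewrite !indicE; congr (_%:R); congr (_ : bool).
  by apply: asbool_equiv_eq; rewrite (dyadic_filtration_cylindrical Am xy).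
rewrite Rintegral_mkcond [RHS]Rintegral_mkcond.
have rE k : f k \_ A = (fun x => f k x * \1_A x) by rewrite patch_indic.
rewrite !rE; elim: n mn => [|n IH]; first by rewrite leqn0 => /eqP->.
rewrite leq_eqVlt => /predU1P[->//|]; rewrite ltnS => mn.
rewrite (Rintegral_walsh_martingaleS _ hA) IH//.
(* Both kernels evaluate the indicator at zero, so the increment contributes nothing. *)
rewrite !Rintegral_kernel//; first by ring.
  exact: cylindricalW hA.
by apply: cylindricalW hA; apply: leqW.
Qed.

Lemma walsh_coef_martingale i : c 0%N = 0 ->
  walsh_coef mu f i = c (trunc_log 2 i).
Proof.
move=> c0; have hi : cylindrical i (walsh R i).
  by apply: cylindrical_walsh; rewrite ltn_expl.
(* The sequence is constant once i < 2^k. At i = 0 the coefficient is 0, while [trunc_log 2 0] is 0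
   by convention; [c 0 = 0] reconciles the two. *)
have E k : \int[mu]_x (f k x * walsh R i x) =
    if (i < 2 ^ k)%N then c (trunc_log 2 i) else 0.
  elim: k => [|k IH].
    rewrite expn0 ltnS leqn0.
    have -> : (fun x => f 0 x * walsh R i x) = cst 0.
      by apply/funext => x; rewrite /f /walsh_martingale big_ord0 mul0r.
    rewrite Rintegral_cst// mul0r; case: eqP => // ->.
    by rewrite trunc_log0 c0.
  rewrite (Rintegral_walsh_martingaleS _ hi) IH !Rintegral_kernel_walsh//.
  have [ik|ki] := ltnP i (2 ^ k).
    by rewrite (leq_trans ik) ?leq_exp2l// subrr mulr0 addr0.
  have [ik|_] := ltnP i (2 ^ k.+1); last by rewrite subrr mulr0 addr0.
  by rewrite (@trunc_log_eq 2 k i)// ?ki ?ik//= add0r subr0 mulr1.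
rewrite /walsh_coef; apply/lim_near_cst => //; exists i => // k /= ik.
by rewrite E (leq_trans (ltn_expl i (isT : (1 < 2)%N)))// leq_exp2l.
Qed.

End martingale.

(** * The maximal function and membership in the Hardy space *)

Section hardy.
Variables (R : realType) (mu : probability G R) (hmu : is_haar mu).
Variables (c : nat -> R) (b : R).
Hypotheses (b1 : 1 <= b) (cb : forall m, 0 <= c m <= b ^+ m).
Let f := walsh_martingale c.
Let t := 2 * b.

Lemma walsh_martingale_step m x :
  `|c m * (dyadic_kernel R m.+1 x - dyadic_kernel R m x)| <= 3 * t ^+ m.
Proof.
have /andP[c0 cm] := cb m.
rewrite normrM ger0_norm// /t exprMn mulrA mulrC ler_pM//.
have D k : 0 <= dyadic_kernel R k x <= 2 ^+ k.
  by rewrite dyadic_kernel_ge0/= /dyadic_kernel ler_piMr ?exprn_ge0.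
have := D m; have := D m.+1; rewrite exprS ler_norml; lra.
Qed.

Lemma walsh_martingale_bound n x : `|f n x| <= 3 * t ^+ n.
Proof.
have t2 : 2 <= t by have := b1; rewrite /t; lra.
elim: n => [|n IH].
  by rewrite /f /walsh_martingale big_ord0 normr0 expr0 mulr1.
rewrite /f walsh_martingaleS (le_trans (ler_normD _ _))//.
have := walsh_martingale_step n x; rewrite exprS.
have : 0 <= t ^+ n by rewrite exprn_ge0//; lra.
move: IH; rewrite /f; nra.
Qed.

(** Increments vanish outside the interval of their level around zero, so the values at [x] freeze
    once [x] has left it; k is the last earlier level still containing [x], or 0 at the start. *)
Lemma walsh_martingale_bound_interval n x : exists k,
  dyadic_interval k dyadic_zero x /\ `|f n x| <= 3 * t * t ^+ k.
Proof.
elim: n => [|n [k [kx fk]]].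
  exists 0%N; split=> //; rewrite /f /walsh_martingale big_ord0 normr0.
  by have := b1; rewrite expr0 /t; lra.
have [xn|xn] := pselect (dyadic_interval n dyadic_zero x).
  by exists n; split=> //; rewrite -mulrA -exprS; exact: walsh_martingale_bound.
exists k; split=> //; rewrite /f walsh_martingaleS /dyadic_kernel !indicE.
rewrite !memNset ?mulr0 ?subrr ?mulr0 ?addr0//.
by move=> /(dyadic_interval_sub (leqnSn n)).
Qed.

(** The p-th power of the maximal function is dominated by a series of kernels with geometric
    weights; each kernel has integral 1, so the integral is at most K / (1 - r). *)
Lemma walsh_martingale_in_Hp (p : R) : 0 < p -> t `^ p < 2 -> in_Hp mu p f.
Proof.
move=> p0 tp; have t0 : 0 <= t by have := b1; rewrite /t; lra.
(* Chosen so that K * r^k * 2^k = (3 * t * t^k)^p, the p-th power of the bound at level k. *)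
pose r := t `^ p / 2; pose K := (3 * t) `^ p.
have r0 : 0 <= r by rewrite divr_ge0// powR_ge0.
have r1 : r < 1 by rewrite /r ltr_pdivrMr// mul1r.
have K0 : 0 <= K by rewrite powR_ge0.
pose g k x := (K * r ^+ k * dyadic_kernel R k x)%:E.
have g0 k x : (0 <= g k x)%E.
  by rewrite lee_fin mulr_ge0 ?dyadic_kernel_ge0// mulr_ge0// exprn_ge0.
pose S x : \bar R := (\sum_(k <oo) g k x)%E.
have S0 x : (0 <= S x)%E by apply: nneseries_ge0 => *; exact: g0.
have mg k : measurable_fun setT (g k).
  apply/measurable_EFinP; apply: (@cylindrical_measurable _ _ k) => x y xy.
  by rewrite /g (@cylindrical_kernel R k x y xy).
have fS n x : ((`|f n x| `^ p)%:E <= S x)%E.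
  have [k [kx fk]] := walsh_martingale_bound_interval n x.
  apply: (@le_trans _ _ (g k x)).
    rewrite lee_fin /g /dyadic_kernel indicE mem_set// mulr1.
    rewrite /r exprMn exprVn -mulrA mulfVK ?expf_neq0//.
    have t3 : 0 <= 3 * t by rewrite mulr_ge0.
    rewrite /K -exprn_powR// -powRM ?exprn_ge0//.
    apply: ge0_ler_powR => //; first exact: ltW.
    by rewrite nnegrE mulr_ge0// exprn_ge0.
  apply: le_trans (@nneseries_lim_ge _ _ xpredT _ k.+1 _) => //.
  by rewrite big_nat_recr//= leeDr// sume_ge0.
have max0 x : (0 <= maximal_fun f x)%E.
  by apply: le_ereal_sup_tmp; exists `|f 0%N x|%:E => //; exists 0%N.
have maxS x : ((maximal_fun f x `^ p) <= S x)%E.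
  (* Taking p-th roots first reduces the claim to a bound on each member of the supremum. *)
  have -> : S x = ((S x `^ p^-1) `^ p)%E.
    by rewrite -poweRrM mulVf ?gt_eqF// poweRe1.
  apply: gt0_ler_poweR; rewrite ?in_itv/= ?leey ?andbT ?poweR_ge0//.
    exact: ltW.
  apply: ge_ereal_sup => _ [n _ <-].
  have -> : `|f n x|%:E = ((`|f n x| `^ p)%:E `^ p^-1)%E.
    by rewrite poweR_EFin -powRrM divff ?gt_eqF// powRr1.
  by apply: gt0_ler_poweR; rewrite ?in_itv/= ?leey ?andbT ?lee_fin ?powR_ge0//
    invr_ge0 ltW.
have mmax : measurable_fun setT (maximal_fun f).
  have -> : maximal_fun f = fun x => esups (fun n => `|f n x|%:E) 0.
    apply/funext => x; rewrite /maximal_fun /esups/=; congr ereal_sup.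
    by apply/seteqP; split=> _ [n _ <-]; exists n.
  apply: (@measurable_fun_esups _ _ _ _ (fun n x => `|f n x|%:E)) => n.
  apply/measurable_EFinP; apply: (@cylindrical_measurable _ _ n) => x y xy.
  by rewrite /f (@cylindrical_walsh_martingale R c n x y xy).
rewrite /in_Hp unlock; apply: poweR_lty.
apply: (@le_lt_trans _ _ (\int[mu]_x S x)%E).
  apply: ge0_le_integral => //.
  - by move=> x _; exact: poweR_ge0.
  - apply: (measurableT_comp (measurable_poweR _)) => //.
    exact: measurableT_comp.
  - exact: ge0_emeasurable_sum.
  - by move=> x _; rewrite gee0_abs// maxS.
rewrite integral_nneseries//.
apply: (@le_lt_trans _ _ (K / (1 - r))%:E); last exact: ltry.
apply: lime_le.
  by apply: is_cvg_nneseries => k _ _; apply: integral_ge0 => x _; exact: g0.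
apply: nearW => n.
rewrite (eq_bigr (fun k => (K * r ^+ k)%:E)); last first.
  move=> k _; rewrite /g; under eq_integral do rewrite EFinM.
  rewrite ge0_integralZl//.
  - by rewrite integral_dyadic_kernel// mule1.
  - apply/measurable_EFinP.
    exact: cylindrical_measurable (@cylindrical_kernel R k).
  - by move=> x _; rewrite lee_fin dyadic_kernel_ge0.
  - by rewrite lee_fin mulr_ge0// exprn_ge0.
rewrite sumEFin lee_fin -mulr_sumr ler_wpM2l// big_mkord.
rewrite -[leRHS]mul1r ler_pdivlMr ?subr_gt0//.
have := subrX1 r n; have : 0 <= r ^+ n by rewrite exprn_ge0.
lra.
Qed.

End hardy.

(** * Lower bounds for the Cesàro means and divergence *)

Lemma cesaro_number_gap_gt0 {R : realType} (alpha : R) :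
  0 < alpha -> alpha <= 56%:R / 100%:R ->
  0 < cesaro_number (alpha - 1) 1 - 3 / 2 * cesaro_number (alpha - 1) 3.
Proof.
move=> a0 a1; rewrite !cesaro_numberS cesaro_number0.
(* The second factor vanishes at (sqrt 17 - 3) / 2 = 0.5615..., just above 0.56. *)
suff : 0 < alpha * (4 - (alpha + 1) * (alpha + 2)) by lra.
by rewrite mulr_gt0//; nra.
Qed.

(** The term i = 0 has modulus B (A_1 - A_3) and the others together at most B A_3 / 2, so the
    reverse triangle inequality applies. *)
Lemma cesaro_sum_quarter_ge {R : realType} (g B : R) (v : nat -> R) M :
  -1 < g <= 0 -> `|v 0%N| = B -> (forall i, `|v i| <= B) ->
  B * (cesaro_number g 1 - 3 / 2 * cesaro_number g 3) <=
  `|\sum_(0 <= i < M.+1)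
      (cesaro_number g (4 * i + 3) - cesaro_number g (4 * i + 1)) * v i|.
Proof.
move=> g01 v0 vB; have B0 : 0 <= B by rewrite -v0.
have decr i : 0 <= cesaro_number g (4 * i + 1) - cesaro_number g (4 * i + 3).
  by rewrite subr_ge0 cesaro_number_nonincreasing// leq_add2l.
rewrite big_ltn// [X in `|_ + X|]big_nat addrC.
apply: le_trans (lerB_normD _ _); rewrite normrM v0 muln0 !add0n.
have head := decr 0%N; rewrite muln0 !add0n in head.
rewrite distrC (ger0_norm head).
set T := \sum_(_ <= _ < _ | _) _.
suff : `|T| <= B * (cesaro_number g 3 / 2) by lra.
apply: le_trans (ler_norm_sum _ _ _) _.
apply: le_trans (ler_wpM2l B0 (cesaro_number_tail M g01)).
rewrite mulr_sumr -big_nat ler_sum// => i _.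
by rewrite normrM distrC (ger0_norm (decr i)) mulrC ler_wpM2r.
Qed.

(** Only the level [l] of the supremum is kept; [A] lies in the corresponding level set. *)
Lemma weak_Lnorm_ge {R : realType} (mu : probability G R) (p l : R)
    (g : G -> R) (A : set G) :
  0 < p -> 0 < l -> measurable A -> measurable_fun setT g ->
  (forall x, A x -> l < `|g x|) ->
  ((l * fine (mu A) `^ p^-1)%:E <= weak_Lnorm mu p g)%E.
Proof.
move=> p0 l0 mA mg lg.
have -> : (l * fine (mu A) `^ p^-1)%:E = (((l `^ p)%:E * mu A) `^ p^-1)%E.
  rewrite -[X in (_ * X)%E]fineK ?fin_num_measure// -EFinM poweR_EFin.
  have m0 : 0 <= fine (mu A) by rewrite fine_ge0.
  by rewrite powRM ?powR_ge0// -powRrM divff ?gt_eqF// powRr1// ltW.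
apply: gt0_ler_poweR.
- by rewrite invr_ge0 ltW.
- by rewrite in_itv/= leey mule_ge0// lee_fin powR_ge0.
- rewrite in_itv/= leey andbT; apply: le_ereal_sup_tmp.
  exists ((l `^ p)%:E * mu [set x | (l < `|g x|)%R])%E; first by exists l.
  by rewrite mule_ge0// lee_fin powR_ge0.
apply: le_ereal_sup_tmp.
exists ((l `^ p)%:E * mu [set x | (l < `|g x|)%R])%E; first by exists l.
rewrite lee_wpmul2l ?lee_fin ?powR_ge0// le_measure// ?inE//.
have : measurable_fun setT (fun x => `|g x|) by exact: measurableT_comp.
move=> /(_ measurableT `]l, +oo[%classic); rewrite setTI.
move=> /(_ (measurable_itv _)); congr measurable.
by apply/seteqP; split=> x /=; rewrite in_itv/= andbT.
Qed.

Section divergence.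
Variables (R : realType) (mu : probability G R) (hmu : is_haar mu).
Variables (alpha b : R).
Hypotheses (alpha0 : 0 < alpha) (alpha1 : alpha <= 56%:R / 100%:R).
Hypothesis b1 : 1 <= b.

(* Vanishing below [2] makes the Walsh coefficients constant on each block
   [4q, 4q + 4), including [q = 0]. *)
Let c (m : nat) : R := if (m < 2)%N then 0 else b ^+ m.
Let f := walsh_martingale c.
Let gap := cesaro_number (alpha - 1) 1 - 3 / 2 * cesaro_number (alpha - 1) 3.

Let b0 : 0 <= b. Proof. exact: le_trans b1. Qed.

Let c_le m n : (m <= n)%N -> c m <= c n.
Proof.
move=> mn; rewrite /c; case: ifP => m2; case: ifP => n2 //.
- by rewrite exprn_ge0.
- by lia.
- by rewrite ler_weXn2l.
Qed.

Lemma cesaro_mean_lower j (x : G) : x 0%N -> x 1%N ->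
  b ^+ j.+2 * gap / ((1 + alpha) * (2 `^ alpha) ^+ j.+3) <=
  `|cesaro_mean mu alpha f (2 ^ j.+3) x|.
Proof.
move=> x0 x1; have a0 := alpha0; have a1 := alpha1.
have g01 : -1 < alpha - 1 <= 0 by apply/andP; split; lra.
have coefE i : walsh_coef mu f i = c (trunc_log 2 i).
  exact: walsh_coef_martingale.
have cE q r : (r < 4)%N ->
    c (trunc_log 2 (4 * q + r)) = c (trunc_log 2 (4 * q)).
  move=> r4; have [->|q0] := posnP q; first by case: r r4 => [|[|[|[|]]]].
  have logE r' : (r' < 4)%N -> trunc_log 2 (4 * q + r') = (trunc_log 2 q).+2.
    move=> r'4; apply: trunc_log_eq => //.
    have /andP[] := trunc_log_bounds (isT : (1 < 2)%N) q0.
    rewrite !expnS; move: (2 ^ _)%N => u uq qu; lia.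
  by rewrite logE// -[(4 * q)%N]addn0 logE.
(* The 2^(j+3) indices split into M + 1 = 2^(j+1) blocks of four. *)
have [M ME] : exists M, (2 ^ j.+3 = 4 * M.+1)%N.
  by exists (2 ^ j.+1).-1; rewrite prednK ?expn_gt0// -(expnD 2 2).
rewrite /cesaro_mean normrM; set A := cesaro_number alpha _.
have A0 : 0 < A by apply: cesaro_number_gt0; lra.
have Ale : A <= (1 + alpha) * (2 `^ alpha) ^+ j.+3.
  rewrite /A -[X in cesaro_number _ X]prednK ?expn_gt0//.
  apply: le_trans (cesaro_number_le_powR _ alpha0) _.
  by rewrite prednK ?expn_gt0// natrX exprn_powR.
pose v i := c (trunc_log 2 (4 * (M.+1 - i.+1))) *
  walsh R (M.+1 - i.+1) (dyadic_shift (dyadic_shift x)).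
have -> : \sum_(1 <= k < (2 ^ j.+3).+1)
    cesaro_number (alpha - 1) (2 ^ j.+3 - k) * walsh_sum mu f k x =
  \sum_(0 <= i < M.+1) (cesaro_number (alpha - 1) (4 * i + 3) -
    cesaro_number (alpha - 1) (4 * i + 1)) * v i.
  rewrite ME -(@cesaro_sum_quarter R _ (fun i => c (trunc_log 2 i)))//.
  apply: eq_bigr => k _; congr (_ * _); rewrite /walsh_sum.
  by apply: eq_bigr => i _; rewrite coefE.
have c_ge0 m : 0 <= c m by rewrite /c; case: ifP => // _; rewrite exprn_ge0.
have vE i : `|v i| = c (trunc_log 2 (4 * (M.+1 - i.+1))).
  by rewrite normrM normr_walsh mulr1 ger0_norm.
(* The term i = 0 comes from the last block, which starts at 2^(j+3) - 4 >= 2^(j+2). *)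
have bc : b ^+ j.+2 <= c (trunc_log 2 (4 * (M.+1 - 1))).
  suff : c j.+2 <= c (trunc_log 2 (4 * (M.+1 - 1))) by [].
  apply: c_le; rewrite trunc_log_max//.
  move: ME (expn_gt0 2 j); rewrite !expnS; move: (2 ^ j)%N => u; lia.
have gap0 : 0 < gap by exact: cesaro_number_gap_gt0.
have X0 : 0 < (1 + alpha) * (2 `^ alpha) ^+ j.+3.
  by rewrite mulr_gt0 ?exprn_gt0 ?powR_gt0//; lra.
rewrite [leLHS]mulrC ler_pM//.
- by rewrite invr_ge0 ltW.
- by rewrite mulr_ge0 ?exprn_ge0// ltW.
- by rewrite gtr0_norm ?invr_gt0// lef_pV2.
apply: le_trans (cesaro_sum_quarter_ge M g01 (vE 0%N) _).
  by rewrite ler_wpM2r// ltW.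
by move=> i; rewrite vE; apply/c_le/leq_trunc_log; rewrite leq_mul2l leq_sub2l.
Qed.

Lemma measurable_cesaro_mean n :
  measurable_fun setT (cesaro_mean mu alpha f n).
Proof.
apply: (@cylindrical_measurable _ _ n) => x y xy; rewrite /cesaro_mean.
congr (_ * _); rewrite !big_nat; apply: eq_bigr => k /andP[_ kn]; congr (_ * _).
apply: eq_bigr => i _; congr (_ * _); apply: walsh_local.
by apply: dyadic_interval_sub xy; have := ltn_ord i; lia.
Qed.

Lemma weak_Lnorm_cesaro_mean_unbounded p : 0 < p -> 2 `^ alpha < b ->
  ereal_sup (range (fun n =>
    weak_Lnorm mu p (cesaro_mean mu alpha f (2 ^ n)))) = +oo%E.
Proof.
move=> p0 ab; have a0 := alpha0.
have gap0 : 0 < gap by exact: cesaro_number_gap_gt0.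
have a20 : 0 < 2 `^ alpha by rewrite powR_gt0.
pose rho := b / 2 `^ alpha; have rho1 : 1 < rho by rewrite ltr_pdivlMr// mul1r.
(* A Bernoulli-type bound: linear growth suffices for divergence. *)
have rho_ge n : n%:R * (rho - 1) <= rho ^+ n.
  elim: n => [|n IH]; first by rewrite mul0r expr0.
  have : 1 <= rho ^+ n by rewrite exprn_ege1// ltW.
  by rewrite exprS -natr1; nra.
pose Q : set G := dyadic_interval 2 (fun=> true).
have muQ : fine (mu Q) = 2^-1 ^+ 2.
  by rewrite /Q (_ : mu _ = (2^-1 ^+ 2)%:E)//; exact: haar_dyadic_interval.
(* The constant left in [l / 2] times the p-th root of 1/4 after extracting rho^(N+3); the extra [b]
   compensates for the exponent N + 2 of [b] in [l]. *)
pose K := gap / (2 * (b * (1 + alpha))) * (2^-1 ^+ 2) `^ p^-1.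
have K0 : 0 < K.
  rewrite mulr_gt0 ?powR_gt0 ?exprn_gt0 ?invr_gt0// divr_gt0// mulr_gt0//.
  by rewrite mulr_gt0//; lra.
apply/eqyP => C C0.
pose N := Num.bound (C / (K * (rho - 1))).
have NC : C <= K * rho ^+ N.+3.
  have KR0 : 0 < K * (rho - 1) by apply: mulr_gt0 => //; rewrite subr_gt0.
  have h : C / (K * (rho - 1)) < N%:R by apply/archi_boundP/ltW/divr_gt0.
  rewrite ltr_pdivrMr// in h.
  apply/ltW/(lt_le_trans h); rewrite mulrCA; apply: (ler_wpM2l (ltW K0)).
  apply: le_trans (rho_ge N.+3); rewrite ler_pM2r ?subr_gt0// ler_nat.
  exact/leqW/leqW/leqnSn.
apply: le_ereal_sup_tmp.
exists (weak_Lnorm mu p (cesaro_mean mu alpha f (2 ^ N.+3))).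
  by exists N.+3.
pose l := b ^+ N.+2 * gap / ((1 + alpha) * (2 `^ alpha) ^+ N.+3).
have bN : 0 < b ^+ N.+2 by apply/exprn_gt0/(lt_le_trans _ b1).
have l0 : 0 < l.
  by apply: divr_gt0; apply: mulr_gt0 => //; rewrite ?addr_gt0 ?exprn_gt0.
(* Halving [l] turns the lower bound of the means on [Q] into the strict inequality of the weak
   norm. *)
apply: le_trans (@weak_Lnorm_ge R mu p (l / 2) _ Q p0 _ _ _ _).
- rewrite lee_fin muQ; suff -> : l / 2 * (2^-1 ^+ 2) `^ p^-1 = K * rho ^+ N.+3.
    exact: NC.
  have alg (u B X q g : R) : 0 < u -> 0 < X ->
      B * g / (u * X) / 2 * q = g / (2 * (b * u)) * q * (b * B / X).
    by move=> u0 X0; field; rewrite !gt_eqF//; exact: lt_le_trans b1.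
  rewrite /K /l /rho expr_div_n [b ^+ N.+3]exprS alg ?exprn_gt0//.
  by rewrite addr_gt0.
- by rewrite divr_gt0.
- exact: dyadic_interval_measurable.
- exact: measurable_cesaro_mean.
move=> x Qx; apply: lt_le_trans (@cesaro_mean_lower N x _ _); rewrite ?Qx//.
by rewrite -/l ltr_pdivrMr// ltr_pMr// ltr1n.
Qed.

End divergence.

Theorem corollary3 (R : realType) (mu : probability dyadic_group R)
    (hmu : is_haar mu) (alpha p : R)
    (alpha_gt0 : 0 < alpha) (alpha_le : alpha <= 56%:R / 100%:R)
    (p_gt0 : 0 < p) (p_lt : p < 1 / (1 + alpha)) :
  exists f : nat -> dyadic_group -> R,
    [/\ dyadic_martingale mu f, in_Hp mu p f &
        ereal_sup (range (fun n : nat =>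
          weak_Lnorm mu p (cesaro_mean mu alpha f (2 ^ n)%N))) = +oo%E].
Proof.
have p1 : 1 + alpha < p^-1.
  rewrite -[1 + alpha]invrK ltf_pV2 ?posrE ?invr_gt0//; last by lra.
  by move: p_lt; rewrite div1r.
(* The midpoint of [alpha] and 1/p - 1: above [alpha] for divergence, below 1/p - 1 for membership
   in the Hardy space. *)
pose s := (p^-1 - 1 + alpha) / 2.
have b1 : 1 <= 2 `^ s by rewrite -[leLHS](powRr0 2) ler_powR//; rewrite /s; lra.
exists (walsh_martingale (fun m => if (m < 2)%N then 0 else (2 `^ s) ^+ m)).
split.
- exact: walsh_martingaleP.
- apply: (@walsh_martingale_in_Hp R mu hmu _ _ b1) => //.
    move=> m; case: ifP => _; first by rewrite lexx exprn_ge0// powR_ge0.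
    by rewrite exprn_ge0 ?powR_ge0/=.
  have -> : 2 * 2 `^ s = 2 `^ (1 + s) :> R.
    by rewrite powRD ?powRr1// pnatr_eq0 implybT.
  rewrite -powRrM -[ltRHS]powRr1// ltr_powR ?ltr1n//.
  by rewrite -ltr_pdivlMr// div1r /s; lra.
apply: weak_Lnorm_cesaro_mean_unbounded => //.
by apply: ltr_powR; rewrite ?ltr1n// /s; lra.
Qed.
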